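(* Consider the problem $$(\mathrm{CP})\qquad\inf_{\mathbf x\in\mathbb R^n}\{f(\mathbf x): g_i(\mathbf x)\le0,\ i=1,\dots,m\},$$ where $f=s_0+p_0$ and $g_i=s_i+p_i$ ($i=1,\dots,m$) are convex polynomials such that, for each $i=0,1,\dots,m$, $s_i(\mathbf x)=\sum_{j=1}^n u_i^j(x_j)$ with each $u_i^j$ a convex univariate polynomial in $x_j$ of degree at most $2d_j$, and $p_i$ is an SOS-convex polynomial of degree at most $2r$. Let $d_0:=\max_{1\le j\le n}d_j$ and assume $d_0>r$ and that $f$ is bounded from below on the feasible set $\mathbf F=\{\mathbf x: g_i(\mathbf x)\le0,\ i=1,\dots,m\}$. Assume there exists $\widehat{\mathbf x}\in\mathbf F$ with $g_i(\widehat{\mathbf x})<0$ for all $i$. If $\bar{\mathbf y}\in\mathbb R^{s(n,2d_0)}$ is an optimal solution of the problem $(\widetilde{\mathrm D}^{\mathrm{SPLD}}_{\mathrm{sos}})$ defined in the context, then $\bar{\mathbf x}:=(\bar y_{\boldsymbol\alpha})_{|\boldsymbol\alpha|=1}\in\mathbb R^n$ is an optimal solution of $(\mathrm{CP})$.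
   Context: A polynomial is SOS-convex if its Hessian is an SOS matrix polynomial, i.e., $\nabla^2 p(\mathbf x)=F(\mathbf x)^TF(\mathbf x)$ for some matrix polynomial $F$. $\mathbb N^n_d=\{\boldsymbol\alpha\in\mathbb N^n:|\boldsymbol\alpha|\le d\}$; $\lceil\mathbf x\rceil_r=(\mathbf x^{\boldsymbol\alpha})_{\boldsymbol\alpha\in\mathbb N^n_r}$; $s(n,d)=\binom{n+d}{d}$; $\lceil x_j\rceil_{d}=(1,x_j,\dots,x_j^{d})^T$; $(M)_{\boldsymbol\alpha}$ is the coefficient matrix of $\mathbf x^{\boldsymbol\alpha}$ in a polynomial matrix $M$, and $h_{\boldsymbol\alpha}$ the coefficient of $\mathbf x^{\boldsymbol\alpha}$ in a polynomial $h$. $(\widetilde{\mathrm D}^{\mathrm{SPLD}}_{\mathrm{sos}})$: minimize $\sum_{\boldsymbol\alpha\in\mathbb N^n_{2d_0}}f_{\boldsymbol\alpha}y_{\boldsymbol\alpha}$ over $\mathbf y=(y_{\boldsymbol\alpha})_{\boldsymbol\alpha\in\mathbb N^n_{2d_0}}\in\mathbb R^{s(n,2d_0)}$ subject to $\sum_{\boldsymbol\alpha\in\mathbb N^n_{2d_0}}(g_i)_{\boldsymbol\alpha}y_{\boldsymbol\alpha}\le0$, $i=1,\dots,m$; $\sum_{\boldsymbol\alpha\in\mathbb N^n_{2d_0}}y_{\boldsymbol\alpha}(\lceil x_j\rceil_{d_j}\lceil x_j\rceil_{d_j}^T)_{\boldsymbol\alpha}\succeq0$, $j=1,\dots,n$;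 $\sum_{\boldsymbol\alpha\in\mathbb N^n_{2d_0}}y_{\boldsymbol\alpha}(\lceil\mathbf x\rceil_r\lceil\mathbf x\rceil_r^T)_{\boldsymbol\alpha}\succeq0$; $y_{\mathbf 0}=1$. *)

(* Defs.v *)
From HB Require Import structures.
From mathcomp Require Import all_boot all_order all_algebra.
From mathcomp Require Import reals.
From mathcomp Require Import mpoly.

Set Implicit Arguments.
Unset Strict Implicit.
Unset Printing Implicit Defensive.

Import Order.TTheory GRing.Theory Num.Theory.
Local Open Scope ring_scope.

Section Defs.
Variable R : realType.
Variable n : nat.

Definition convex_mpoly (p : {mpoly R[n]}) : Prop :=
  forall (x y : 'I_n -> R) (t : R), 0 <= t <= 1 ->
    p.@[fun k => t * x k + (1 - t) * y k] <= t * p.@[x] + (1 - t) * p.@[y].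

Definition convex_poly (q : {poly R}) : Prop :=
  forall (x y t : R), 0 <= t <= 1 ->
    q.[t * x + (1 - t) * y] <= t * q.[x] + (1 - t) * q.[y].

Definition univ (j : 'I_n) (q : {poly R}) : {mpoly R[n]} :=
  (map_poly (@mpolyC n R) q).['X_j].

Definition hessian (p : {mpoly R[n]}) : 'M[{mpoly R[n]}]_n :=
  \matrix_(i, j) mderiv i (mderiv j p).

Definition sos_matrix (H : 'M[{mpoly R[n]}]_n) : Prop :=
  exists k (F : 'M[{mpoly R[n]}]_(k, n)), H = F^T *m F.

Definition sos_convex (p : {mpoly R[n]}) : Prop := sos_matrix (hessian p).

Definition psd (T : finType) (M : T -> T -> R) : Prop :=
  forall v : T -> R, 0 <= \sum_(a : T) \sum_(b : T) v a * M a b * v b.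

(* sum_{alpha in N^n_D} h_alpha y_alpha  (coefficients vanish off the support) *)
Definition Lfun (D : nat) (y : 'X_{1..n} -> R) (h : {mpoly R[n]}) : R :=
  \sum_(a <- msupp h | (mdeg a <= D)%N) h@_a * y a.

Definition cp_feasible (m : nat) (g : 'I_m -> {mpoly R[n]}) (x : 'I_n -> R) : Prop :=
  forall i, (g i).@[x] <= 0.

Definition cp_optimal (m : nat) (f : {mpoly R[n]}) (g : 'I_m -> {mpoly R[n]})
    (x : 'I_n -> R) : Prop :=
  cp_feasible g x /\ forall z, cp_feasible g z -> f.@[x] <= f.@[z].

(* Problem (~D^SPLD_sos); the variable y is indexed by all monomials but only the
   coordinates with |alpha| <= 2 d0 occur in the objective and constraints. *)
Definition spld_feasible (d : 'I_n -> nat) (r m : nat) (g : 'I_m -> {mpoly R[n]})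
    (y : 'X_{1..n} -> R) : Prop :=
  let D := (2 * \max_(j < n) d j)%N in
  [/\ forall i, Lfun D y (g i) <= 0,
      (* sum_alpha y_alpha (ceil(x_j)_{d_j} ceil(x_j)_{d_j}^T)_alpha >= 0 *)
      forall j, psd (fun a b : 'I_(d j).+1 => y (U_(j) *+ (a + b))%MM),
      (* sum_alpha y_alpha (ceil(x)_r ceil(x)_r^T)_alpha >= 0 *)
      psd (fun b c : 'X_{1..n < r.+1} => y (bmnm b + bmnm c)%MM) &
      y 0%MM = 1].

Definition spld_optimal (d : 'I_n -> nat) (r m : nat) (f : {mpoly R[n]})
    (g : 'I_m -> {mpoly R[n]}) (y : 'X_{1..n} -> R) : Prop :=
  let D := (2 * \max_(j < n) d j)%N in
  spld_feasible d r g y /\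
  forall z, spld_feasible d r g z -> Lfun D y f <= Lfun D z f.

End Defs.

(* Main.v *)
(**
Let [L] be the moment functional [Lfun D y] of a feasible [y].  It is linear,
[L 1 = 1], and [L] is nonnegative on squares of polynomials of degree at most
[r] and of univariate polynomials in [x_j] of degree at most [d_j].  This yields
Jensen's inequality [h(xbar) <= L(h)] at the mean [xbar_j = L(x_j)] for [h = f]
and for every [h = g_i].  Hence [xbar] is feasible, and since the moment vector
of a feasible point [z] is feasible for the relaxation,
[f(xbar) <= L(f) <= f(z)].

For the separable part, the gap between a convex univariate polynomial and its
tangent at [xbar_j] is nonnegative, hence a sum of squares.  For an SOS-convex
[p], the univariate polynomial [phi(s) = L(p(xbar + s (x - xbar)))] satisfies
[phi(0) = p(xbar)], [phi(1) = L(p)], [phi'(0) = 0], and [phi''(s)] is the value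
of [L] at a sum of squares of polynomials of degree at most [r]; so
[phi(1) >= phi(0)].
*)
Require Import Defs.
From HB Require Import structures.
From mathcomp Require Import all_boot all_order all_algebra.
From mathcomp Require Import reals.
From mathcomp Require Import polyrcf zify ring lra.
From mathcomp Require Import ssrcomplements mpoly.

Set Implicit Arguments.
Unset Strict Implicit.
Unset Printing Implicit Defensive.

Import Order.TTheory GRing.Theory Num.Theory.
Local Open Scope ring_scope.

Section NonnegativePolynomials.
Variable R : rcfType.
Implicit Types (p q h : {poly R}) (a b x : R).

Lemma horner_ge0_closure p a :
  (forall e, 0 < e -> exists2 x, `|x - a| < e & 0 <= p.[x]) -> 0 <= p.[a].
Proof.
move=> p_ge0; rewrite leNgt; apply/negP => pa_lt0.
have [|e e_gt0 p_near] := @poly_cont R a p (- p.[a]); first by rewrite oppr_gt0.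
have [x /p_near] := p_ge0 e e_gt0.
by rewrite ltr_norml ltrBlDr addNr leNgt => /andP[_ ->].
Qed.

Lemma horner_ge0_right p a b : a < b ->
  (forall x, a < x < b -> 0 <= p.[x]) -> 0 <= p.[a].
Proof.
move=> ab p_ge0; apply: horner_ge0_closure => e e_gt0.
pose m := Num.min e (b - a).
have m_gt0 : 0 < m by rewrite lt_min e_gt0 subr_gt0.
have [me mb] : m <= e /\ m <= b - a by rewrite /m !ge_min !lexx orbT.
exists (a + m / 2); first by rewrite addrC addKr ger0_norm; lra.
by apply: p_ge0; apply/andP; split; lra.
Qed.

Lemma nonneg_poly_double_root q a : (forall x, 0 <= q.[x]) -> root q a ->
  exists2 h, q = ('X - a%:P) ^+ 2 * h & forall x, 0 <= h.[x].
Proof.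
move=> q_ge0 /factor_theorem[q1 qE].
have q1_root : root q1 a.
  apply/eqP/le_anti/andP; split; last first.
    apply: (@horner_ge0_right _ _ (a + 1)) => [|x /andP[ax _]]; first by lra.
    by have := q_ge0 x; rewrite qE !hornerE pmulr_lge0 // subr_gt0.
  rewrite -oppr_ge0 -hornerN; apply: horner_ge0_closure => e e_gt0.
  exists (a - e / 2); first by rewrite addrC addKr normrN ger0_norm; lra.
  have := q_ge0 (a - e / 2); rewrite qE !hornerE oppr_ge0 nmulr_lge0 //; lra.
have [h q1E] := factor_theorem _ _ q1_root.
have {}qE : q = ('X - a%:P) ^+ 2 * h by rewrite qE q1E; ring.
have h_ge0 x : x != a -> 0 <= h.[x].
  move=> xa; have := q_ge0 x; rewrite qE !hornerE pmulr_rge0 //.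
  by rewrite exprn_even_gt0 //= subr_eq0.
exists h => // x; have [->|/h_ge0 //] := eqVneq x a.
apply: (@horner_ge0_right _ _ (a + 1)) => [|y /andP[ay _]]; first by lra.
by rewrite h_ge0 // gt_eqF.
Qed.

Lemma critical_point_le_horner p a b x : x \in `[a, b] ->
  exists2 c, c \in [:: a, b & roots p^`() a b] & p.[c] <= p.[x].
Proof.
rewrite in_itv /= => /andP[ax xb]; set p' := p^`().
have [p'0|p'_neq0] := eqVneq p' 0.
  exists a; rewrite ?mem_head //.
  apply: (@ler_hornerW _ a b p); rewrite ?in_itv /=; try by lra.
  by move=> y _; rewrite -/p' p'0 horner0.
have [p'x_lt0|p'x_gt0|p'x0] := ltrgt0P p'.[x]; last first.
- exists x => //; rewrite !inE in_roots p'_neq0 rootE p'x0 eqxx in_itv /=; lra.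
- exists (next_root p' x b).
    rewrite !inE; case: next_rootP => [/eqP|y _ p'y0 y_xb _|y _ -> _].
    + by rewrite (negbTE p'_neq0).
    + by rewrite in_roots p'_neq0 rootE p'y0 eqxx !in_itv /= in y_xb *; lra.
    + by rewrite max_l // eqxx orbT.
  have := next_root_in p' x b; rewrite in_itv /= => /andP[x_next _].
  apply: (@dernrW _ p x (next_root p' x b)) => [z z_next|].
    by rewrite -sgr_lt0 (sgr_neighprN _ z_next) ?lt_eqF // sgr_lt0.
  by rewrite in_itv /= x_next lexx.
- exists (prev_root p' a x).
    rewrite !inE; case: prev_rootP => [/eqP|y _ p'y0 y_ax _|y _ -> _].
    + by rewrite (negbTE p'_neq0).
    + by rewrite in_roots p'_neq0 rootE p'y0 eqxx !in_itv /= in y_ax *; lra.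
    + by rewrite min_l // eqxx.
  have := prev_root_in p' a x; rewrite in_itv /= => /andP[_ prev_x].
  apply: (@derplW _ p (prev_root p' a x) x) => [z z_prev|].
    by rewrite -sgr_gt0 (sgr_neighplN _ z_prev) ?rootE ?gt_eqF // sgr_gt0.
  by rewrite in_itv /= prev_x lexx.
Qed.

Lemma poly_itv_min p a b : a <= b ->
  exists2 c, c \in `[a, b] & {in `[a, b], forall x, p.[c] <= p.[x]}.
Proof.
move=> ab; pose s := [:: a, b & roots p^`() a b].
have [i _ i_min] :=
  @arg_minP _ _ _ (ord0 : 'I_(size s)) xpredT (fun i => p.[s`_i]) isT.
exists s`_i => [|x /(critical_point_le_horner p)[_ /(nthP 0)[j js <-]]].
  have : s`_i \in s by rewrite mem_nth.
  rewrite 2!in_cons => /or3P[/eqP->|/eqP->|/roots_in].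
  - by rewrite in_itv /= lexx.
  - by rewrite in_itv /= lexx andbT.
  - exact: subset_itv_oo_cc.
by apply: le_trans; exact: (i_min (Ordinal js)).
Qed.

Lemma nonneg_poly_ge_horner0 q : (forall x, 0 <= q.[x]) ->
  exists b, forall x, b <= x -> q.[0] <= q.[x].
Proof.
move=> q_ge0; have [q1|q1] := leqP (size q) 1.
  by exists 0 => x _; rewrite (size1_polyC q1) !hornerC.
have lq_gt0 : 0 < lead_coef q.
  rewrite lt_def lead_coef_eq0 -size_poly_gt0 (ltnW q1) leNgt; apply/negP.
  rewrite -oppr_gt0 -lead_coefN => lq_gt0.
  have [b /(_ b (lexx b))] := poly_pinfty_gt_lc lq_gt0.
  by move/(lt_le_trans lq_gt0); rewrite hornerN oppr_gt0 ltNge q_ge0.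
have lqE : lead_coef (q - q.[0]%:P) = lead_coef q.
  by rewrite lead_coefDl // size_polyN (leq_ltn_trans (size_polyC_leq1 _)).
have /poly_pinfty_gt_lc[b q_large] : 0 < lead_coef (q - q.[0]%:P).
  by rewrite lqE.
exists b => x /q_large; rewrite lqE !hornerE => /(lt_le_trans lq_gt0)/ltW.
by rewrite subr_ge0.
Qed.

Lemma nonneg_poly_min q : (forall x, 0 <= q.[x]) ->
  exists a, forall x, q.[a] <= q.[x].
Proof.
move=> q_ge0; have [b q_right] := nonneg_poly_ge_horner0 q_ge0.
have [|c q_left] := @nonneg_poly_ge_horner0 (q \Po - 'X).
  by move=> x; rewrite horner_comp.
pose B := Num.max 0 (Num.max b c).
have [B_ge0 bB cB] : [/\ 0 <= B, b <= B & c <= B].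
  by rewrite /B !le_max !lexx !orbT.
have [|a _ a_min] := @poly_itv_min q (- B) B; first by lra.
have qa0 : q.[a] <= q.[0] by apply: a_min; rewrite in_itv /= oppr_le0 B_ge0.
exists a => x; have [xB|Bx] := leP `|x| B.
  by apply: a_min; rewrite in_itv /= -ler_norml.
apply: le_trans qa0 _; move: Bx; rewrite lter_normr => /orP[Bx|Bx].
  by apply: q_right; lra.
have := q_left (- x); rewrite !horner_comp !hornerE oppr0 opprK; apply; lra.
Qed.

(* The gap between a nonnegative polynomial and its minimum, attained at [a],
   has a double root at [a]; dividing it out lowers the degree by two. *)
Lemma nonneg_poly_sos d q :
  (forall x, 0 <= q.[x]) -> (size q <= (2 * d).+1)%N ->
  exists2 hs : seq {poly R}, q = \sum_(h <- hs) h ^+ 2 &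
    forall h, h \in hs -> (size h <= d.+1)%N.
Proof.
elim: d q => [|d IHd] q q_ge0 size_q.
  move/size1_polyC: size_q => qE; exists [:: (Num.sqrt q`_0)%:P].
    rewrite big_seq1 -polyC_exp sqr_sqrtr //.
    by have := q_ge0 0; rewrite {1}qE hornerC.
  by move=> h; rewrite inE => /eqP->; apply: size_polyC_leq1.
have [a a_min] := nonneg_poly_min q_ge0.
have [x||q1 gapE q1_ge0] := @nonneg_poly_double_root (q - q.[a]%:P) a.
- by rewrite !hornerE subr_ge0.
- by rewrite /root !hornerE subrr.
have [|hs q1E size_hs] := IHd q1 q1_ge0.
  have [->|q1_neq0] := eqVneq q1 0; first by rewrite size_poly0.
  have: (size (q - q.[a]%:P)%R <= (2 * d).+3)%N.
    rewrite (leq_trans (size_polyD _ _)) // geq_max size_polyN.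
    rewrite (leq_trans (size_polyC_leq1 _)) // andbT.
    by rewrite mulnS in size_q.
  by rewrite gapE size_monicM ?monic_exp ?monicXsubC // size_exp_XsubC.
exists ((Num.sqrt q.[a])%:P :: [seq ('X - a%:P) * h | h <- hs]).
  rewrite big_cons big_map -polyC_exp sqr_sqrtr ?q_ge0 //.
  under eq_bigr do rewrite exprMn.
  by rewrite -mulr_sumr -q1E -gapE addrC subrK.
move=> h; rewrite inE => /predU1P[->|/mapP[k /size_hs size_k ->]].
  by rewrite (leq_trans (size_polyC_leq1 _)).
by rewrite (leq_trans (size_polyMleq _ _)) // size_XsubC /= ltnS.
Qed.

End NonnegativePolynomials.

Definition tangent (R : nzRingType) (v : {poly R}) (a : R) : {poly R} :=
  v.[a]%:P + v^`().[a] *: ('X - a%:P).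

Lemma size_tangent (R : nzRingType) (v : {poly R}) a :
  (size (tangent v a) <= size v)%N.
Proof.
have [v1|v1] := leqP (size v) 1.
  rewrite /tangent (size1_polyC v1) derivC horner0 scale0r addr0 hornerC.
  exact: leqnn.
apply: leq_trans (size_polyD _ _) _; rewrite geq_max.
rewrite (leq_trans (size_polyC_leq1 _)) ?(ltnW v1) //=.
by rewrite (leq_trans (size_scale_leq _ _)) // size_XsubC.
Qed.

Lemma horner_tangent (R : nzRingType) (v : {poly R}) a x :
  (tangent v a).[x] = v.[a] + v^`().[a] * (x - a).
Proof. by rewrite /tangent !hornerE. Qed.

Lemma tangent_le_deriv2 (R : rcfType) (v : {poly R}) a x :
  (forall t, 0 <= v^`()^`().[t]) -> (tangent v a).[x] <= v.[x].
Proof.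
move=> v''_ge0; rewrite horner_tangent -lerBrDl.
have v'_homo (b c : R) : b <= c -> v^`().[b] <= v^`().[c].
  move=> bc; have bb_cc : (b \in `[b, c]) * (c \in `[b, c]).
    by rewrite !in_itv /= !lexx bc.
  by apply: (@ler_hornerW _ b c v^`()); rewrite ?bb_cc.
have [ax|xa|->] := ltrgtP a x; last by rewrite !subrr mulr0.
  have [c c_ax ->] := poly_mvt v ax.
  by rewrite ler_pM2r ?subr_gt0 // v'_homo // (itvP c_ax).
have [c c_xa vE] := poly_mvt v xa.
rewrite -[leRHS]opprB vE -mulrN opprB ler_nM2r ?subr_lt0 //.
by rewrite v'_homo // (itvP c_xa).
Qed.

Lemma tangent_le_convex (R : realType) (v : {poly R}) a x :
  convex_poly v -> (tangent v a).[x] <= v.[x].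
Proof.
move=> v_convex; rewrite horner_tangent.
pose chord_gap := v.[a]%:P + (v.[x] - v.[a]) *: 'X
                  - (v \Po (a%:P + (x - a) *: 'X)).
have gap_root : root chord_gap 0.
  by rewrite /root !hornerE horner_comp !hornerE subrr.
have [w gapE] := factor_theorem _ _ gap_root.
have w0 : w.[0] = v.[x] - v.[a] - v^`().[a] * (x - a).
  have -> : w.[0] = chord_gap^`().[0].
    by rewrite gapE derivM !derivE !hornerE; ring.
  rewrite /chord_gap !derivE deriv_comp !derivE !hornerE horner_comp.
  by rewrite !hornerE /= mulr1.
have : 0 <= w.[0].
  apply: (@horner_ge0_right _ w 0 1) => // t /andP[t_gt0 t_lt1].
  rewrite -(pmulr_lge0 _ t_gt0) -[t in _ * t]subr0.
  have -> : w.[t] * (t - 0) = chord_gap.[t] by rewrite gapE !hornerE.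
  have /(v_convex x a) : 0 <= t <= 1 by rewrite !ltW.
  have -> : t * x + (1 - t) * a = a + (x - a) * t by ring.
  by rewrite !hornerE horner_comp !hornerE; lra.
by rewrite w0; lra.
Qed.

Lemma convex_poly_jensen (R : realType) (L : {scalar {poly R}}) d
    (v : {poly R}) :
  L 1 = 1 -> (forall h : {poly R}, (size h <= d.+1)%N -> 0 <= L (h ^+ 2)) ->
  convex_poly v -> (size v <= (2 * d).+1)%N -> v.[L 'X] <= L v.
Proof.
move=> L1 L_sqr_ge0 v_convex size_v; set a := L 'X.
have LC c : L c%:P = c by rewrite -[c%:P]alg_polyC linearZ /= L1 mulr1.
have L_tangent : L (tangent v a) = v.[a].
  by rewrite linearD linearZ linearB /= !LC subrr mulr0 addr0.
have [x||hs gapE size_hs] := @nonneg_poly_sos _ d (v - tangent v a).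
- by rewrite hornerD hornerN subr_ge0 tangent_le_convex.
- apply: leq_trans (size_polyD _ _) _.
  by rewrite geq_max size_polyN size_v (leq_trans (size_tangent _ _)).
rewrite -L_tangent -subr_ge0 -linearB gapE linear_sum big_seq.
by apply: sumr_ge0 => h /size_hs; apply: L_sqr_ge0.
Qed.

Section TotalDegree.
Variables (R : nzRingType) (n : nat).
Implicit Types (p q : {mpoly R[n]}).

Lemma leq_msizeP k p :
  reflect (forall m, m \in msupp p -> (mdeg m < k)%N) (msize p <= k)%N.
Proof.
rewrite msizeE; apply: (iffP (bigmax_leqP_seq _ _ _ _)) => mdeg_lt m.
  by move=> mp; apply: mdeg_lt.
by move=> mp _; apply: mdeg_lt.
Qed.

Lemma leq_msizeC k (c : R) : (msize (c%:MP_[n]) <= k.+1)%N.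
Proof. by rewrite msizeC (leq_trans (leq_b1 _)). Qed.

Lemma leq_msize_XsubC j (c : R) : (msize ('X_j - c%:MP_[n]) <= 2)%N.
Proof.
rewrite (leq_trans (msizeD_le _ _)) // msizeN geq_max leq_msizeC.
by rewrite msizeX mdeg1.
Qed.

Lemma leq_msizeM j k p q :
  (msize p <= j)%N -> (msize q <= k.+1)%N -> (msize (p * q) <= j + k)%N.
Proof.
move=> /leq_msizeP pj /leq_msizeP qk; apply/leq_msizeP => m.
move=> /msuppM_le/allpairsP[[m1 m2] [/pj m1j /qk m2k ->]].
by rewrite mdegD -addSn leq_add.
Qed.

Lemma leq_msize_mderiv i p : (msize p^`M(i) <= (msize p).-1)%N.
Proof.
apply/leq_msizeP => m; rewrite mcoeff_msupp mcoeff_mderiv => nz_coeff.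
have : (m + U_(i))%MM \in msupp p.
  by rewrite mcoeff_msupp; apply: contraNneq nz_coeff => ->; rewrite mul0rn.
by move/msize_mdeg_lt; rewrite mdegD mdeg1 addn1; case: (msize p).
Qed.

End TotalDegree.

Lemma leq_msize_mmap (R : nzRingType) (n k : nat) (h : 'I_n -> {mpoly R[k]}) d e
    (p : {mpoly R[n]}) :
  (forall i, msize (h i) <= e.+1)%N -> (msize p <= d.+1)%N ->
  (msize (mmap (@mpolyC k R) h p) <= (d * e).+1)%N.
Proof.
move=> msize_h msize_p; apply: leq_trans (msize_sum _ _ _) _; rewrite big_seq.
apply/bigmax_leqP_seq => m _ /msize_mdeg_lt/leq_trans/(_ msize_p).
rewrite ltnS => mdeg_m; rewrite mul_mpolyC (leq_trans (msizeZ_le _ _)) //.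
apply: (@leq_trans (mdeg m * e).+1); last by rewrite ltnS leq_mul2r mdeg_m orbT.
rewrite mdegE big_distrl /= /mmap1.
apply: (big_ind2 (fun (q : {mpoly R[k]}) b => (msize q <= b.+1)%N)).
- by rewrite msize1.
- by move=> q1 b1 q2 b2; apply: (@leq_msizeM _ _ b1.+1).
move=> i _; elim: (m i) => [|b IHb]; first by rewrite expr0 msize1.
by rewrite exprS mulSn (@leq_msizeM _ _ e.+1).
Qed.

(* The squared coefficients at the largest leading monomial cannot cancel. *)
Lemma msize_sum_sqr (R : realDomainType) (n : nat) (I : finType)
    (h : I -> {mpoly R[n]}) i :
  (2 * msize (h i) <= (msize (\sum_j h j ^+ 2)).+1)%N.
Proof.
have [->|hi_neq0] := eqVneq (h i) 0; first by rewrite msize0.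
have [i0 hi0_neq0 lead_max] :=
  @arg_maxP _ _ _ i (fun j => h j != 0) (fun j => mlead (h j)) hi_neq0.
set M := mlead (h i0) in lead_max.
have lead_le j : (mlead (h j) <= M)%O.
  have [->|/lead_max //] := eqVneq (h j) 0; by rewrite mlead0 le0x.
have : (M + M)%MM \in msupp (\sum_j h j ^+ 2).
  rewrite mcoeff_msupp raddf_sum /=.
  under eq_bigr do rewrite expr2 mleadcMW //.
  rewrite gt_eqF // (bigD1 i0) //= ltr_wpDr //.
    by apply: sumr_ge0 => j _; rewrite -expr2 sqr_ge0.
  by rewrite -expr2 exprn_even_gt0 //= mleadc_eq0.
move/msize_mdeg_lt; rewrite mdegD => MM_lt.
have : (msize (h i) <= (mdeg M).+1)%N.
  by rewrite -(mlead_deg hi_neq0) ltnS lemc_mdeg.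
lia.
Qed.

Lemma mpoly_ring_ind (n : nat) (R : nzRingType) (P : {mpoly R[n]} -> Prop) :
  (forall c, P c%:MP) -> (forall i, P 'X_i) ->
  (forall p q, P p -> P q -> P (p + q)) ->
  (forall p q, P p -> P q -> P (p * q)) -> forall p, P p.
Proof.
move=> PC PX PD PM p; rewrite (mpolyE p).
have P0 : P 0 by rewrite -mpolyC0.
have P1 : P 1 by rewrite -mpolyC1.
apply: big_ind => // m _; rewrite -mul_mpolyC; apply: (PM) => //.
rewrite mpolyXE_id; apply: big_ind => // i _.
by elim: (m i) => [|k IHk]; rewrite ?expr0 // exprS; apply: (PM).
Qed.

Lemma eq_mmap (n : nat) (R S : nzRingType) (f : R -> S) (h1 h2 : 'I_n -> S) p :
  h1 =1 h2 -> mmap f h1 p = mmap f h2 p.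
Proof.
by move=> eq_h; apply: eq_bigr => m _; congr (_ * _); apply: mmap1_eq.
Qed.

Section MmapPoly.
Variables (n : nat) (R : nzRingType) (S : comNzRingType).
Variables (f : {rmorphism R -> S}) (h : 'I_n -> {poly S}).
Implicit Types p : {mpoly R[n]}.

Lemma horner_mmap p s :
  (mmap (polyC \o f) h p).[s] = mmap f (fun i => (h i).[s]) p.
Proof.
rewrite /mmap horner_sum; apply: eq_bigr => m _.
rewrite hornerM hornerC horner_prod.
by congr (_ * _); apply: eq_bigr => i _; rewrite horner_exp.
Qed.

Lemma deriv_mmap p :
  (mmap (polyC \o f) h p)^`() = \sum_i mmap (polyC \o f) h p^`M(i) * (h i)^`().
Proof.
elim/mpoly_ring_ind: p => [c|j|p q IHp IHq|p q IHp IHq].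
- rewrite mmapC derivC big1 // => i _.
  by rewrite mderivC mmap0 mul0r.
- rewrite mmapX mmap1U (bigD1 j) //= big1 ?addr0 => [|i ij].
    rewrite mderivX mnm1E eqxx scale1r -{1}[U_(j)%MM]add0m addmK.
    by rewrite mpolyX0 rmorph1 mul1r.
  by rewrite mderivX mnm1E eq_sym (negbTE ij) scale0r mmap0 mul0r.
- rewrite mmapD derivD IHp IHq -big_split; apply: eq_bigr => i _ /=.
  by rewrite mderivD mmapD mulrDl.
- rewrite rmorphM /= derivM IHp IHq mulr_suml mulr_sumr -big_split.
  apply: eq_bigr => i _ /=.
  by rewrite mderivM mmapD !rmorphM /=; ring.
Qed.

End MmapPoly.

Lemma horner_map_scalar (R : comNzRingType) (A : algType R) (L : {scalar A})
    (P : {poly A}) s :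
  (map_poly L P).[s] = L P.[s%:A].
Proof.
rewrite (horner_coef_wide _ (size_poly _ _)) horner_coef linear_sum.
apply: eq_bigr => i _.
by rewrite coef_map exprZn expr1n mulr_algr linearZ mulrC.
Qed.

Lemma deriv_map_additive (A B : nzRingType) (L : {additive A -> B})
    (P : {poly A}) :
  (map_poly L P)^`() = map_poly L P^`().
Proof. by apply/polyP => i; rewrite !(coef_map, coef_deriv) /= raddfMn. Qed.

(* [segment a p] is [p (a + s (x - a))] as a polynomial in [s]. *)
Definition segment (R : comNzRingType) (n : nat) (a : 'I_n -> R)
    (p : {mpoly R[n]}) : {poly {mpoly R[n]}} :=
  mmap (polyC \o @mpolyC n R)
    (fun j => (a j)%:MP%:P + ('X_j - (a j)%:MP) *: 'X) p.

Definition hessian_factor (R : comNzRingType) (n k : nat)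
    (F : 'M[{mpoly R[n]}]_(k, n)) (p : {mpoly R[n]}) : Prop :=
  forall i j, p^`M(j)^`M(i) = \sum_l F l i * F l j.

Section Segment.
Variables (R : comNzRingType) (n : nat) (a : 'I_n -> R).
Implicit Types p : {mpoly R[n]}.

HB.instance Definition _ := GRing.RMorphism.copy (segment a)
  (mmap (polyC \o @mpolyC n R) _).

Lemma horner_segment p s :
  (segment a p).[s] = mmap (@mpolyC n R)
    (fun j => (a j)%:MP + ('X_j - (a j)%:MP) * s) p.
Proof.
by rewrite /segment horner_mmap; apply: eq_mmap => j; rewrite !hornerE.
Qed.

Lemma segment0 p : (segment a p).[0] = p.@[a]%:MP.
Proof.
rewrite horner_segment /meval /mmap raddf_sum; apply: eq_bigr => m _.
rewrite /= mpolyCM rmorph_prod; congr (_ * _); apply: eq_bigr => j _.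
by rewrite mulr0 addr0 rmorphXn.
Qed.

Lemma segment1 p : (segment a p).[1] = p.
Proof.
rewrite horner_segment -[RHS]comp_mpoly_id; apply: eq_mmap => j.
by rewrite mulr1 addrC subrK tnth_mktuple.
Qed.

Lemma deriv_segment p :
  (segment a p)^`() = \sum_j segment a p^`M(j) * ('X_j - (a j)%:MP)%:P.
Proof.
rewrite /segment deriv_mmap; apply: eq_bigr => j _.
by rewrite derivD derivC add0r derivZ derivX alg_polyC.
Qed.

Lemma leq_msize_segment p s : (msize (segment a p).[s%:MP] <= msize p)%N.
Proof.
rewrite horner_segment.
have [->|p_neq0] := eqVneq p 0; first by rewrite mmap0 msize0.
rewrite (mpolySpred _ p_neq0) -[_.-1]muln1.
apply: leq_msize_mmap => [j|]; last by rewrite -mpolySpred.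
rewrite (leq_trans (msizeD_le _ _)) // geq_max leq_msizeC /=.
by rewrite mulrC mul_mpolyC (leq_trans (msizeZ_le _ _)) // leq_msize_XsubC.
Qed.

Lemma deriv2_segment_sos k (F : 'M[{mpoly R[n]}]_(k, n)) p :
  hessian_factor F p ->
  (segment a p)^`()^`() =
    \sum_l (\sum_j segment a (F l j) * ('X_j - (a j)%:MP)%:P) ^+ 2.
Proof.
move=> hessE.
pose dir j := ('X_j - (a j)%:MP)%:P : {poly {mpoly R[n]}}.
have -> : (segment a p)^`()^`() =
    \sum_j \sum_i segment a p^`M(j)^`M(i) * dir i * dir j.
  rewrite deriv_segment raddf_sum; apply: eq_bigr => j _.
  by rewrite -mulr_suml -deriv_segment /= derivM derivC mulr0 addr0.
under [RHS]eq_bigr => l _ do rewrite expr2 mulr_sumr.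
rewrite [RHS]exchange_big; apply: eq_bigr => j _ /=.
under [RHS]eq_bigr => l _ do rewrite mulr_suml.
rewrite [RHS]exchange_big; apply: eq_bigr => i _ /=.
rewrite hessE rmorph_sum !mulr_suml; apply: eq_bigr => l _.
rewrite /= rmorphM /= -/(dir i) -/(dir j) -!mulrA; congr (_ * _).
by rewrite [RHS]mulrCA.
Qed.

End Segment.

Lemma leq_msize_hessian_factor (R : realDomainType) (n k r : nat)
    (p : {mpoly R[n]}) (F : 'M[{mpoly R[n]}]_(k, n)) l j :
  hessian_factor F p -> (msize p <= (2 * r).+1)%N -> (msize (F l j) <= r)%N.
Proof.
move=> hessE msize_p; have := msize_sum_sqr (fun l => F l j) l.
have -> : \sum_l F l j ^+ 2 = p^`M(j)^`M(j).
  by rewrite hessE; under eq_bigr do rewrite expr2.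
have := leq_msize_mderiv j p^`M(j); have := leq_msize_mderiv j p.
lia.
Qed.

Lemma sos_convex_hessian_factor (R : realType) (n : nat) (p : {mpoly R[n]}) :
  sos_convex p -> exists k (F : 'M[{mpoly R[n]}]_(k, n)), hessian_factor F p.
Proof.
move=> [k [F /matrixP hessE]]; exists k, F => i j.
have := hessE i j; rewrite !mxE => ->.
by apply: eq_bigr => l _; rewrite mxE.
Qed.

Lemma sos_convex_jensen (R : realType) (n r : nat)
    (L : {scalar {mpoly R[n]}}) (p : {mpoly R[n]}) :
  L 1 = 1 ->
  (forall h : {mpoly R[n]}, (msize h <= r.+1)%N -> 0 <= L (h ^+ 2)) ->
  sos_convex p -> (msize p <= (2 * r).+1)%N -> p.@[fun j => L 'X_j] <= L p.
Proof.
move=> L1 L_sqr_ge0 /sos_convex_hessian_factor[k [F hessE]] msize_p.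
pose a j := L 'X_j; pose phi := map_poly L (segment a p).
have LC c : L c%:MP = c by rewrite -alg_mpolyC linearZ /= L1 mulr1.
have phi0 : phi.[0] = p.@[a].
  by rewrite horner_map_scalar alg_mpolyC mpolyC0 segment0 LC.
have phi1 : phi.[1] = L p.
  by rewrite horner_map_scalar alg_mpolyC mpolyC1 segment1.
have dphi0 : phi^`().[0] = 0.
  rewrite deriv_map_additive horner_map_scalar alg_mpolyC mpolyC0 deriv_segment.
  rewrite horner_sum linear_sum big1 // => j _.
  rewrite hornerM hornerC segment0 mul_mpolyC linearZ linearB /= LC.
  by rewrite subrr mulr0.
have d2phi_ge0 s : 0 <= phi^`()^`().[s].
  rewrite !deriv_map_additive horner_map_scalar alg_mpolyC.
  rewrite (deriv2_segment_sos _ hessE).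
  rewrite horner_sum linear_sum; apply: sumr_ge0 => l _.
  rewrite horner_exp horner_sum; apply: L_sqr_ge0.
  rewrite (leq_trans (msize_sum _ _ _)) //; apply/bigmax_leqP => j _.
  rewrite hornerM hornerC -[r.+1]addn1; apply: leq_msizeM.
    apply: leq_trans (leq_msize_segment _ _ _) _.
    exact: leq_msize_hessian_factor hessE msize_p.
  exact: leq_msize_XsubC.
have := tangent_le_deriv2 0 1 d2phi_ge0.
by rewrite horner_tangent dphi0 mul0r addr0 phi0 phi1.
Qed.

Section UnivariateEmbedding.
Variables (R : realType) (n : nat) (j : 'I_n).
Implicit Types q : {poly R}.

Lemma univE q k : (size q <= k)%N ->
  univ j q = \sum_(i < k) q`_i *: 'X_[(U_(j) *+ i)%MM].
Proof.
move=> size_q; rewrite /univ (@horner_coef_wide _ k).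
  by apply: eq_bigr => i _; rewrite coef_map /= mpolyXn mul_mpolyC.
by rewrite size_map_inj_poly ?mpolyC0 // => a b /eqP; rewrite mpolyC_eq => /eqP.
Qed.

Lemma univ_is_linear : linear (univ j : {poly R} -> {mpoly R[n]}).
Proof.
move=> c p q; rewrite /univ -mul_polyC rmorphD rmorphM /= map_polyC /=.
by rewrite hornerD hornerM hornerC mul_mpolyC.
Qed.

Lemma univ_is_monoid_morphism :
  monoid_morphism (univ j : {poly R} -> {mpoly R[n]}).
Proof.
by split=> [|p q]; rewrite /univ (rmorph1, rmorphM) (hornerC, hornerM).
Qed.

HB.instance Definition _ :=
  GRing.isLinear.Build R {poly R} {mpoly R[n]} _ (univ j) univ_is_linear.
HB.instance Definition _ := GRing.isMonoidMorphism.Build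
  {poly R} {mpoly R[n]} (univ j) univ_is_monoid_morphism.

Lemma univX : univ j 'X = 'X_j :> {mpoly R[n]}.
Proof. by rewrite /univ map_polyX hornerX. Qed.

Lemma meval_univ q z : (univ j q).@[z] = q.[z j].
Proof.
rewrite (univE (leqnn _)) raddf_sum /= horner_coef; apply: eq_bigr => i _.
by rewrite mevalZ -mpolyXn rmorphXn /= mevalXU.
Qed.

Lemma leq_msize_univ q : (msize (univ j q) <= size q)%N.
Proof.
rewrite (univE (leqnn _)) (leq_trans (msize_sum _ _ _)) //.
apply/bigmax_leqP => i _; rewrite (leq_trans (msizeZ_le _ _)) //.
by rewrite msizeX mdegMn mdeg1 mul1n.
Qed.

End UnivariateEmbedding.

Lemma mulmnDr (n : nat) (m : 'X_{1..n}) i k :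
  (m *+ (i + k) = m *+ i + m *+ k)%MM.
Proof. by apply/mnmP => l; rewrite mnmDE !mulmnE mulnDr. Qed.

Section MomentFunctional.
Variables (R : realType) (n D : nat) (y : 'X_{1..n} -> R).
Implicit Types h : {mpoly R[n]}.

Lemma LfunE h : Lfun D y h = \sum_(b : 'X_{1..n < D.+1}) h@_b * y b.
Proof.
rewrite /Lfun -big_filter (big_mksub 'X_{1..n < D.+1}) /=.
- rewrite big_rmcond //= => b; rewrite mem_filter -ltnS bmdeg /=.
  by move/memN_msupp_eq0 ->; rewrite mul0r.
- by rewrite filter_uniq ?msupp_uniq.
- by move=> m; rewrite mem_filter => /andP[].
Qed.

Lemma Lfun_is_scalar : scalar (Lfun D y).
Proof.
move=> c p h; rewrite !LfunE mulr_sumr -big_split /=; apply: eq_bigr => b _.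
by rewrite mcoeffD mcoeffZ mulrDl mulrA.
Qed.

HB.instance Definition _ :=
  GRing.isLinear.Build R {mpoly R[n]} R _ (Lfun D y) Lfun_is_scalar.

Lemma LfunX m : (mdeg m <= D)%N -> Lfun D y 'X_[m] = y m.
Proof.
by move=> mD; rewrite /Lfun msuppX big_mkcond big_seq1 mD mcoeffX eqxx mul1r.
Qed.

Lemma Lfun1 : Lfun D y 1 = y 0%MM.
Proof. by rewrite -mpolyX0 LfunX ?mdeg0. Qed.

Lemma Lfun_sqr_ge0 (T : finType) (e : T -> 'X_{1..n}) (c : T -> R) :
  (forall a, 2 * mdeg (e a) <= D)%N -> psd (fun a b => y (e a + e b)%MM) ->
  0 <= Lfun D y ((\sum_a c a *: 'X_[e a]) ^+ 2).
Proof.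
move=> mdeg_e /(_ c).
suff -> : Lfun D y ((\sum_a c a *: 'X_[e a]) ^+ 2) =
    \sum_a \sum_b c a * y (e a + e b)%MM * c b by [].
rewrite expr2 mulr_suml linear_sum; apply: eq_bigr => a _.
rewrite mulr_sumr linear_sum; apply: eq_bigr => b _.
rewrite -scalerAl -scalerAr -mpolyXD /= !linearZ /= LfunX; first by ring.
by have := mdeg_e a; have := mdeg_e b; rewrite mdegD; lia.
Qed.

Lemma Lfun_mpoly_sqr_ge0 r h : (2 * r <= D)%N ->
  psd (fun b c : 'X_{1..n < r.+1} => y (bmnm b + bmnm c)%MM) ->
  (msize h <= r.+1)%N -> 0 <= Lfun D y (h ^+ 2).
Proof.
move=> rD y_psd msize_h; rewrite (mpolywE msize_h); apply: Lfun_sqr_ge0 => // b.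
by rewrite (leq_trans _ rD) // leq_pmul2l // -ltnS bmdeg.
Qed.

Lemma Lfun_univ_sqr_ge0 (j : 'I_n) d (q : {poly R}) : (2 * d <= D)%N ->
  psd (fun a b : 'I_d.+1 => y (U_(j) *+ (a + b))%MM) ->
  (size q <= d.+1)%N -> 0 <= Lfun D y (univ j (q ^+ 2)).
Proof.
move=> dD y_psd size_q; rewrite rmorphXn /= (univE j size_q).
apply: Lfun_sqr_ge0 => [a|v].
  by rewrite mdegMn mdeg1 mul1n (leq_trans _ dD) // leq_pmul2l // -ltnS.
by under eq_bigr do under eq_bigr do rewrite -mulmnDr; apply: y_psd.
Qed.

End MomentFunctional.

Section Moments.
Variables (R : realType) (n : nat) (z : 'I_n -> R).

Definition moments (m : 'X_{1..n}) : R := ('X_[m] : {mpoly R[n]}).@[z].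

Lemma momentsD m1 m2 : moments (m1 + m2)%MM = moments m1 * moments m2.
Proof. by rewrite /moments mpolyXD mevalM. Qed.

Lemma Lfun_moments D h : (msize h <= D.+1)%N -> Lfun D moments h = h.@[z].
Proof.
move=> msize_h; rewrite {2}(mpolywE msize_h) LfunE raddf_sum.
by apply: eq_bigr => b _; rewrite /= mevalZ.
Qed.

Lemma psd_rank_one (T : finType) (w : T -> R) : psd (fun b c => w b * w c).
Proof.
move=> v.
suff -> : \sum_b \sum_c v b * (w b * w c) * v c = (\sum_b v b * w b) ^+ 2.
  exact: sqr_ge0.
rewrite expr2 mulr_suml; apply: eq_bigr => b _; rewrite mulr_sumr.
by apply: eq_bigr => c _; ring.
Qed.

Lemma spld_feasible_moments (d : 'I_n -> nat) (r m : nat)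
    (g : 'I_m -> {mpoly R[n]}) :
  (forall i, (msize (g i) <= (2 * \max_(j < n) d j).+1)%N) ->
  cp_feasible g z -> spld_feasible d r g moments.
Proof.
move=> msize_g z_feasible; split=> [i|j v|v|].
- by rewrite Lfun_moments.
- under eq_bigr do under eq_bigr do rewrite mulmnDr momentsD.
  exact: psd_rank_one.
- under eq_bigr do under eq_bigr do rewrite momentsD.
  exact: psd_rank_one.
- by rewrite /moments mpolyX0 meval1.
Qed.

End Moments.

Definition separable_plus_sos_convex (R : realType) (n : nat)
    (d : 'I_n -> nat) (r : nat) (h : {mpoly R[n]}) : Prop :=
  exists (v : 'I_n -> {poly R}) (q : {mpoly R[n]}),
    [/\ h = \sum_(j < n) univ j (v j) + q,
        forall j, convex_poly (v j) /\ (size (v j) <= (2 * d j).+1)%N,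
        sos_convex q & (msize q <= (2 * r).+1)%N].

Section SeparablePlusSosConvex.
Variables (R : realType) (n : nat) (d : 'I_n -> nat) (r : nat).
Hypothesis r_lt_d : (r < \max_(j < n) d j)%N.
Implicit Types h : {mpoly R[n]}.
Local Notation D := (2 * \max_(j < n) d j)%N.

Lemma leq_msize_separable_plus h :
  separable_plus_sos_convex d r h -> (msize h <= D.+1)%N.
Proof.
move=> [v [q [-> v_convex _ msize_q]]].
rewrite (leq_trans (msizeD_le _ _)) // geq_max; apply/andP; split; last by lia.
rewrite (leq_trans (msize_sum _ _ _)) //; apply/bigmax_leqP => j _.
have [_ size_vj] := v_convex j; rewrite (leq_trans (leq_msize_univ j _)) //.
by rewrite (leq_trans size_vj) // ltnS leq_pmul2l // leq_bigmax.
Qed.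

Lemma spld_feasible_jensen m (g : 'I_m -> {mpoly R[n]}) y h :
  spld_feasible d r g y -> separable_plus_sos_convex d r h ->
  h.@[fun j => y U_(j)%MM] <= Lfun D y h.
Proof.
move=> [_ y_psd_univ y_psd_sos y0] [v [q [-> v_convex q_sos msize_q]]].
pose L : {scalar {mpoly R[n]}} := Lfun D y.
have L1 : L 1 = 1 by rewrite /L /= Lfun1.
have D_gt0 : (0 < D)%N by lia.
have LX j : L 'X_j = y U_(j)%MM by rewrite /L /= LfunX ?mdeg1.
rewrite mevalD linearD /= lerD //.
  rewrite raddf_sum linear_sum; apply: ler_sum => j _ /=.
  have [vj_convex size_vj] := v_convex j.
  rewrite meval_univ -LX -univX.
  apply: (@convex_poly_jensen _ (L \o univ j) (d j)) => //= [|w size_w].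
    by rewrite rmorph1.
  apply: Lfun_univ_sqr_ge0 (y_psd_univ j) size_w.
  by rewrite leq_pmul2l // leq_bigmax.
have -> : q.@[fun j => y U_(j)%MM] = q.@[fun j => L 'X_j].
  by apply: eq_mmap => j; rewrite LX.
apply: (@sos_convex_jensen _ _ r L) => // w msize_w.
by apply: Lfun_mpoly_sqr_ge0 y_psd_sos msize_w; lia.
Qed.

End SeparablePlusSosConvex.

Theorem theorem5 (R : realType) (n m r : nat) (d : 'I_n -> nat)
    (u0 : 'I_n -> {poly R}) (p0 : {mpoly R[n]})
    (u : 'I_m -> 'I_n -> {poly R}) (p : 'I_m -> {mpoly R[n]})
    (f : {mpoly R[n]}) (g : 'I_m -> {mpoly R[n]}) :
  f = \sum_(j < n) univ j (u0 j) + p0 ->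
  (forall i, g i = \sum_(j < n) univ j (u i j) + p i) ->
  convex_mpoly f ->
  (forall i, convex_mpoly (g i)) ->
  (forall j, convex_poly (u0 j) /\ (size (u0 j) <= (2 * d j).+1)%N) ->
  (forall i j, convex_poly (u i j) /\ (size (u i j) <= (2 * d j).+1)%N) ->
  sos_convex p0 -> (msize p0 <= (2 * r).+1)%N ->
  (forall i, sos_convex (p i) /\ (msize (p i) <= (2 * r).+1)%N) ->
  (r < \max_(j < n) d j)%N ->
  (exists c : R, forall x, cp_feasible g x -> c <= f.@[x]) ->
  (exists xh : 'I_n -> R, cp_feasible g xh /\ forall i, (g i).@[xh] < 0) ->
  forall ybar : 'X_{1..n} -> R,
    spld_optimal d r f g ybar ->
    cp_optimal f g (fun j => ybar (U_(j))%MM).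
Proof.
move=> fE gE _ _ u0_convex u_convex p0_sos msize_p0 p_sos r_lt_d _ _ y.
move=> [y_feasible y_optimal].
have f_splits : separable_plus_sos_convex d r f by exists u0, p0.
have g_splits i : separable_plus_sos_convex d r (g i).
  by exists (u i), (p i); have [p_sos_i msize_pi] := p_sos i.
have [y_g _ _ _] := y_feasible.
split=> [i|z z_feasible].
  exact: le_trans (spld_feasible_jensen r_lt_d y_feasible (g_splits i)) (y_g i).
apply: le_trans (spld_feasible_jensen r_lt_d y_feasible f_splits) _.
rewrite -(Lfun_moments z (leq_msize_separable_plus r_lt_d f_splits)).
apply: y_optimal; apply: spld_feasible_moments z_feasible => i.
exact: leq_msize_separable_plus (g_splits i).
Qed.
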